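(* Let $d \geq 2$ and $n,k \geq 0$ be integers. Then the number of $d$-ary operator monomials $M \in \mathcal{M}_d$ with $\operatorname{topt}(M) = n$ and $\operatorname{lopt}(M) = k$ equals \[ N_d(n,k) = \frac{1}{n+1} \binom{n+1}{k+1} \binom{ n + (n-k)(d-2)+1}{k}. \]
   Context: Let $\mathcal{A}$ be an associative $d$-ary algebra: a vector space with a multilinear product $(a_1,\dots,a_d)\mapsto a_1\cdots a_d$ satisfying $d$-ary associativity, $a_1 \cdots a_i ( a_{i+1} \cdots a_{i+d} ) a_{i+d+1} \cdots a_{2d-1} = a_1 \cdots a_j ( a_{j+1} \cdots a_{j+d} ) a_{j+d+1} \cdots a_{2d-1}$ for all $0\le i<j\le d-1$, so that parentheses in iterated products may be removed unambiguously. Let $L$ be a linear operator on $\mathcal{A}$. The set $\mathcal{M}_d$ of ($d$-ary) operator monomials is defined recursively: a single indeterminate is an operator monomial; if $M_1,\dots,M_d$ are operator monomials then the product $M_1\cdots M_d$ is one; if $M$ is one then $L(M)$ is one. Monomials are regarded as formal expressions with the $d$-ary product parentheses removed (identified up to $d$-ary associativity) and with indeterminates named $a_1,a_2,\dots$ from left to right; equivalently, an operator monomial is either a single indeterminate, or $L(M')$ with $M'$ an operator monomial, or a concatenation $M_1 M_2\cdots M_\ell$ with $\ell \equiv 1 \pmod{d-1}$, $\ell\ge d$, where each $M_i$ is either a single indeterminate or of the form $L(M_i')$. For example, for $d=3$ the monomials with $3$ total operations include $a_1a_2a_3a_4a_5a_6a_7$, $L(a_1a_2a_3)a_4a_5$,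 $L(L(a_1))a_2a_3$, $L(L(L(a_1)))$. For $M\in\mathcal{M}_d$, $\operatorname{topt}(M)$ is the total number of operations in $M$ (occurrences of $L$ plus number of applications of the $d$-ary product; a monomial with $m$ indeterminates uses $(m-1)/(d-1)$ products), and $\operatorname{lopt}(M)$ is the number of occurrences of $L$. *)

(* Defs.v *)
From HB Require Import structures.
From mathcomp Require Import all_boot all_order all_algebra.

Set Implicit Arguments.
Unset Strict Implicit.
Unset Printing Implicit Defensive.

(* An expression whose product parentheses have been removed is the sequence  *)
(* of its factors, so that the product is concatenation and d-ary             *)
(* associativity holds by construction. The indeterminates are named a_1,     *)
(* a_2, ... from left to right: the position of an indeterminate determines   *)
(* its name, which is therefore not recorded.                                 *)
Inductive factor : Type :=
| Indet
| Lapp of seq factor.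

Notation expr := (seq factor).

Fixpoint factor_encode (f : factor) : GenTree.tree unit :=
  if f is Lapp M then GenTree.Node 0 (map factor_encode M)
  else GenTree.Leaf tt.

Fixpoint factor_decode (t : GenTree.tree unit) : factor :=
  if t is GenTree.Node _ ts then Lapp (map factor_decode ts) else Indet.

Lemma factor_encodeK : cancel factor_encode factor_decode.
Proof.
rewrite /cancel; fix IH 1; case=> [|M] //=; congr Lapp.
by elim: M => [|f M IHM] //=; rewrite IH IHM.
Qed.

HB.instance Definition _ := Countable.copy factor (can_type factor_encodeK).

Inductive opmonomial (d : nat) : expr -> Prop :=
| OpIndet : opmonomial d [:: Indet]
| OpProd (Ms : d.-tuple expr) :
    (forall M, M \in Ms -> opmonomial d M) -> opmonomial d (flatten Ms)
| OpL (M : expr) : opmonomial d M -> opmonomial d [:: Lapp M].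

Fixpoint flopt (f : factor) : nat :=
  if f is Lapp M then (sumn (map flopt M)).+1 else 0.

Definition lopt (M : expr) : nat := sumn (map flopt M).

Fixpoint findets (f : factor) : nat :=
  if f is Lapp M then sumn (map findets M) else 1.

Definition indets (M : expr) : nat := sumn (map findets M).

(* A monomial with m indeterminates uses (m - 1) / (d - 1) products; the      *)
(* lemmas topt_indet, topt_prod and topt_L below show that topt indeed counts *)
(* the operations.                                                            *)
Definition topt (d : nat) (M : expr) : nat :=
  lopt M + (indets M).-1 %/ d.-1.

Lemma indets_flatten (Ms : seq expr) :
  indets (flatten Ms) = \sum_(M <- Ms) indets M.
Proof.
elim: Ms => [|M Ms IH] /=; first by rewrite big_nil.
by rewrite big_cons -IH /indets map_cat sumn_cat.
Qed.

Lemma lopt_flatten (Ms : seq expr) :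
  lopt (flatten Ms) = \sum_(M <- Ms) lopt M.
Proof.
elim: Ms => [|M Ms IH] /=; first by rewrite big_nil.
by rewrite big_cons -IH /lopt map_cat sumn_cat.
Qed.

Lemma indets_sum (d : nat) (Ms : seq expr) :
  (forall M, M \in Ms -> exists q, indets M = (q * d.-1).+1) ->
  \sum_(M <- Ms) indets M
    = (\sum_(M <- Ms) (indets M).-1 %/ d.-1) * d.-1 + size Ms.
Proof.
move=> H; rewrite big_distrl -sum1_size -big_split /=.
apply: eq_big_seq => M /H[q ->] /=.
case: d.-1 => [|e]; first by rewrite !muln0.
by rewrite mulnK // addn1.
Qed.

Lemma opmonomial_indets (d : nat) (M : expr) : 2 <= d ->
  opmonomial d M -> exists q, indets M = (q * d.-1).+1.
Proof.
move=> d_ge2; elim=> [|Ms _ IH|M' _ [q qE]]; first by exists 0.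
- rewrite indets_flatten (indets_sum IH) size_tuple.
  exists (\sum_(M <- Ms) (indets M).-1 %/ d.-1).+1.
  by case: d d_ge2 {IH} Ms => // d' _ Ms; rewrite mulSn /= addnS addnC.
- by exists q; rewrite -qE /indets /= addn0.
Qed.

Lemma topt_indet (d : nat) : topt d [:: Indet] = 0.
Proof. by rewrite /topt /= div0n. Qed.

Lemma topt_L (d : nat) (M : expr) : topt d [:: Lapp M] = (topt d M).+1.
Proof. by rewrite /topt /lopt /indets /= !addn0. Qed.

Lemma topt_prod (d : nat) (Ms : d.-tuple expr) : 2 <= d ->
  (forall M, M \in Ms -> opmonomial d M) ->
  topt d (flatten Ms) = (\sum_(M <- Ms) topt d M).+1.
Proof.
move=> d_ge2 H; rewrite /topt lopt_flatten indets_flatten big_split /=.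
have {}H M : M \in Ms -> exists q, indets M = (q * d.-1).+1.
  by move/H/(opmonomial_indets d_ge2).
rewrite (indets_sum H) size_tuple -addnS; congr addn.
have d1 : 0 < d.-1 by case: d d_ge2 {H Ms} => [|[]].
rewrite -[in X in (_ + X).-1](prednK (ltnW d_ge2)) addnS /=.
by rewrite divnMDl // divnn d1 addn1.
Qed.

(* Main.v *)
(* Write e = d - 1. A monomial is a nonempty plane forest whose number of     *)
(* roots, like the outdegree of each of its L-nodes, is congruent to 1 modulo *)
(* e; wrapping it in one more L makes it a single tree. Let F(r, k, p) be the *)
(* number of forests with r trees, k L-nodes and r + e p leaves. Deleting the *)
(* first root gives                                                           *)
(*   F(r+1, k+1, p) = F(r, k+1, p) + \sum_(j <= p) F(r+1+ej, k, p-j),         *)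
(* from which k F(r, k, p) = r 'C(k-1+r+ep, k-1) 'C(p+k-1, k-1) follows by    *)
(* induction: the total number of nodes, hence the first binomial, is the     *)
(* same for all terms of the sum. The theorem is the value of F(1, k+1, n-k). *)
Require Import Defs.
From mathcomp Require Import all_boot all_order all_algebra.
From mathcomp Require Import zify ring.

Set Implicit Arguments.
Unset Strict Implicit.
Unset Printing Implicit Defensive.

Import GRing.Theory Num.Theory.

(** By [opmonomialP], being a monomial is a congruence condition modulo e = d - 1 on the number of
    roots and on each outdegree, so the theorem counts plane forests. [forests] lists them by
    deleting the first root, completely ([mem_forests]) and without repetition ([uniq_forests]). In
    the recurrence for their number, the sum over j of (r+1+ej) times a binomial in p - j splits
    into two hockey-stick sums, and [size_forests] follows. *)

Lemma factor_mem_ind (P : factor -> Prop) :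
  P Indet -> (forall M, (forall f, f \in M -> P f) -> P (Lapp M)) ->
  forall f, P f.
Proof.
move=> PI PL; fix IH 1; case=> [//|M]; apply: PL.
elim: M => [|g M IHM] f; first by clear IH.
by rewrite inE => /predU1P[->|/IHM]; first apply: IH.
Qed.

(** * Monomials as forests with constrained outdegrees *)

Definition len_ok (e l : nat) : bool := (0 < l) && (e %| l.-1).

Lemma len_okP e l : reflect (exists j, l = (j * e).+1) (len_ok e l).
Proof.
apply: (iffP andP) => [[l_gt0 /dvdnP[j jE]]|[j ->]]; last by rewrite dvdn_mull.
by exists j; rewrite -jE prednK.
Qed.

(** Only arguments of L are constrained: deleting a root may leave any number of roots. *)
Fixpoint factor_wf (e : nat) (f : factor) : bool :=
  if f is Lapp M then len_ok e (size M) && all (factor_wf e) M else true.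

(** Bracket to the right: the first d - 1 factors and the remaining ones, a monomial by induction,
    form the d arguments of one product. *)
Lemma opmonomial_of_factors d M j : 2 <= d -> size M = (j * d.-1).+1 ->
  (forall f, f \in M -> opmonomial d [:: f]) -> opmonomial d M.
Proof.
move=> d_ge2; elim: j M => [|j IHj] M szM HM.
  by case: M szM HM => [|f [|]] // _; apply; rewrite mem_head.
rewrite mulSn in szM.
pose Ms := rcons [seq [:: f] | f <- take d.-1 M] (drop d.-1 M).
have szMs : size Ms == d.
  rewrite size_rcons size_map size_takel ?szM; first by rewrite prednK //; lia.
  by rewrite -addnS leq_addr.
have -> : M = flatten (Tuple szMs).
  by rewrite /= /Ms flatten_rcons flatten_seq1 cat_take_drop.
apply: OpProd => N; rewrite mem_rcons inE => /predU1P[->|/mapP[f fM ->]].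
  apply: IHj => [|f /mem_drop/HM//]; by rewrite size_drop szM -addnS addKn.
by apply/HM/(mem_take fM).
Qed.

Lemma opmonomialP d M : 2 <= d ->
  opmonomial d M <-> len_ok d.-1 (size M) && all (factor_wf d.-1) M.
Proof.
move=> d_ge2; split.
  elim=> [|Ms _ IH|N _ /= ->]; [by rewrite /len_ok dvdn0 | |].
    apply/andP; split; last first.
      by apply/allP=> f /flattenP[N /IH/andP[_ /allP]]; apply.
    have [q qE] : exists q, size (flatten Ms) = q * d.-1 + size Ms.
      have {}IH N : N \in tval Ms -> len_ok d.-1 (size N).
        by move=> /IH/andP[].
      elim: (tval Ms) IH => [|N s IHs] IH /=; first by exists 0.
      have [|q qE] := IHs.
        by move=> N' N's; apply: IH; rewrite inE N's orbT.
      have /len_okP[j jE] := IH N (mem_head _ _).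
      rewrite size_cat qE jE; exists (j + q); rewrite mulnDl; lia.
    apply/len_okP; exists q.+1.
    by rewrite qE size_tuple mulSn addnC -addSn prednK // ltnW.
  by rewrite /len_ok dvdn0.
case/andP=> /len_okP[j szM] /allP wfM; apply: opmonomial_of_factors szM _ => //.
move=> f /wfM; elim/factor_mem_ind: f {M j wfM} => [_|M IH] /=.
  exact: OpIndet.
case/andP=> /len_okP[j szM] /allP wfM; apply: OpL.
by apply: opmonomial_of_factors szM _ => // f fM; apply: IH (wfM f fM).
Qed.

(** * Exhaustive enumeration of forests *)

Definition wrap (l : nat) (M : expr) : expr := Lapp (take l M) :: drop l M.

(** The deleted first root is put back: either a leaf, or, by [wrap], an L-node taking the first
    je+1 trees as its children. *)
Fixpoint forests (e k : nat) : nat -> nat -> seq expr :=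
  if k is k'.+1 then
    fix forests_k r p := if r is r'.+1 then
        [seq Indet :: M | M <- forests_k r' p] ++
        [seq wrap (j * e).+1 M | j <- iota 0 p.+1,
                                 M <- forests e k' ((j * e).+1 + r') (p - j)]
      else [::]
  else fun r p => if p is 0 then [:: nseq r Indet] else [::].

Lemma forestsSS e k r p :
  forests e k.+1 r.+1 p =
    [seq Indet :: M | M <- forests e k.+1 r p] ++
    [seq wrap (j * e).+1 M | j <- iota 0 p.+1,
                             M <- forests e k ((j * e).+1 + r) (p - j)].
Proof. by []. Qed.

Lemma lopt_cat M N : lopt (M ++ N) = lopt M + lopt N.
Proof. by rewrite /lopt map_cat sumn_cat. Qed.

Lemma indets_cat M N : indets (M ++ N) = indets M + indets N.
Proof. by rewrite /indets map_cat sumn_cat. Qed.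

Lemma lopt_cons f M : lopt (f :: M) = flopt f + lopt M. Proof. by []. Qed.

Lemma indets_cons f M : indets (f :: M) = findets f + indets M.
Proof. by []. Qed.

Lemma flopt_Lapp M : flopt (Lapp M) = (lopt M).+1. Proof. by []. Qed.

Lemma findets_Lapp M : findets (Lapp M) = indets M. Proof. by []. Qed.

Lemma lopt_wrap l M : lopt (wrap l M) = (lopt M).+1.
Proof. by rewrite lopt_cons flopt_Lapp addSn -lopt_cat cat_take_drop. Qed.

Lemma indets_wrap l M : indets (wrap l M) = indets M.
Proof. by rewrite indets_cons findets_Lapp -indets_cat cat_take_drop. Qed.

Lemma wrap_cat M N : wrap (size M) (M ++ N) = Lapp M :: N.
Proof. by rewrite /wrap take_size_cat // drop_size_cat. Qed.

Lemma lopt_eq0 M : lopt M = 0 -> M = nseq (size M) Indet.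
Proof.
by elim: M => [//|[|N] M IHM]; rewrite lopt_cons //= add0n => /IHM <-.
Qed.

Lemma lopt_nseq r : lopt (nseq r Indet) = 0.
Proof. by elim: r. Qed.

Lemma indets_nseq r : indets (nseq r Indet) = r.
Proof. by elim: r => // r IH; rewrite indets_cons IH. Qed.

Lemma size_le_indets e M : all (factor_wf e) M -> size M <= indets M.
Proof.
have len1 f : factor_wf e f -> 0 < findets f.
  elim/factor_mem_ind: f => [//|N IH] /=.
  case: N IH => // f N IH /and3P[_ wff _] /=.
  by rewrite ltn_addr // IH ?mem_head.
by elim: M => [//|f M IHM] /= /andP[/len1 ? /IHM ?]; rewrite indets_cons; lia.
Qed.

Lemma mem_forests e k r p M : 0 < e ->
  M \in forests e k r p <->
  [/\ size M = r, lopt M = k, indets M = r + p * e & all (factor_wf e) M].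
Proof.
move=> e_gt0; elim: k r p M => [|k IHk] r p M.
  split.
    case: p => //=; rewrite inE => /eqP->.
    by rewrite size_nseq lopt_nseq indets_nseq addn0 all_nseq orbT.
  case=> szM /lopt_eq0 ME; rewrite ME szM indets_nseq => pE _.
  by case: p pE => [|p] /=; [rewrite inE|rewrite mulSn; lia].
elim: r M => [|r IHr] M.
  by split=> // -[/size0nil->].
rewrite forestsSS mem_cat; split.
  case/orP=> [/mapP[N /IHr[szN lN iN wfN] ->]|].
    by split=> //=; rewrite ?szN // indets_cons iN.
  case/allpairsPdep=> j [N [jp /IHk[szN lN iN wfN] ->]].
  rewrite lopt_wrap indets_wrap lN iN /= size_drop szN.
  rewrite size_takel ?szN ?leq_addr // addKn.
  split=> //; [by move: jp; rewrite mem_iota; nia |].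
  rewrite -andbA -all_cat cat_take_drop wfN andbT.
  by apply/len_okP; exists j.
case: M => [|[|N] M] [] //; rewrite lopt_cons indets_cons.
  move=> [szM] lM iM wfM; apply/orP; left; apply: map_f.
  by apply/IHr; split=> //; move: iM => /=; lia.
rewrite flopt_Lapp findets_Lapp => -[szM] [lM] iM.
rewrite [all _ _]/= -andbA => /and3P[/len_okP[j szN] wfN wfM].
(* Each tree has a leaf, so the je+1+r trees of [N ++ M] need at most r+1+pe leaves. This makes p -
   j a genuine difference. *)
have le_jp : j <= p.
  have := size_le_indets wfN; have := size_le_indets wfM.
  by rewrite szM szN => ? ?; rewrite -(leq_pmul2r e_gt0); lia.
apply/orP; right; apply/allpairsPdep.
exists j, (N ++ M); split; first by rewrite mem_iota.
  apply/IHk; rewrite size_cat szN szM lopt_cat indets_cat all_cat wfN wfM.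
  by split=> //; nia.
by rewrite -szN wrap_cat.
Qed.

Lemma uniq_forests e k r p : 0 < e -> uniq (forests e k r p).
Proof.
move=> e_gt0; elim: k r p => [|k IHk] r p; first by case: p.
elim: r => [//|r IHr]; rewrite forestsSS cat_uniq; apply/and3P; split.
- by rewrite map_inj_uniq // => M N [].
- by apply/hasPn=> _ /allpairsPdep[j [N [_ _ ->]]]; apply/mapP=> -[].
- apply: allpairs_uniq_dep; first exact: iota_uniq.
    by move=> j _; apply: IHk.
  move=> _ _ /allpairsPdep[i [M [_ /mem_forests-/(_ e_gt0)[szM _ _ _] ->]]]
             /allpairsPdep[j [N [_ /mem_forests-/(_ e_gt0)[szN _ _ _] ->]]].
  rewrite /= /wrap => -[eq_take eq_drop].
  have eq_ij : i = j.
    have := congr1 size eq_take; rewrite !size_takel ?szM ?szN; try lia.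
    by move=> [/eqP]; rewrite eqn_pmul2r // => /eqP.
  case: _ / eq_ij in eq_take eq_drop *; congr existT.
  by rewrite -(cat_take_drop (i * e).+1 M) eq_take eq_drop cat_take_drop.
Qed.

Arguments forests : simpl never.

(** * Counting the forests *)

Lemma sum_bin_diag m p :
  \sum_(0 <= j < p.+1) 'C(p - j + m, m) = 'C((p + m).+1, m.+1).
Proof.
elim: p => [|p IHp]; first by rewrite big_nat1 !binn.
rewrite big_nat_recl //; under eq_bigr => j _ do rewrite subSS.
by rewrite IHp subn0 addSn binS addnC.
Qed.

(** Passing from p to p + 1 adds the sum of [sum_bin_diag], which is Pascal's rule. *)
Lemma sum_mul_bin_diag m p :
  \sum_(0 <= j < p.+1) j * 'C(p - j + m, m) = 'C((p + m).+1, m.+2).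
Proof.
elim: p => [|p IHp]; first by rewrite big_nat1 mul0n bin_small.
rewrite big_nat_recl // add0n; under eq_bigr => j _ do rewrite subSS mulSn.
by rewrite big_split /= IHp sum_bin_diag addSn [RHS]binS addnC.
Qed.

Lemma size_forests e k r p :
  k.+1 * size (forests e k.+1 r p) = r * 'C(k + r + p * e, k) * 'C(p + k, k).
Proof.
elim: k r p => [|k IHk] r p; elim: r => [|r IHr]; rewrite ?muln0 //.
  (* Deleting the only L-node leaves bare indeterminates, so only j = p contributes. *)
  rewrite forestsSS size_cat size_map mulnDr {}IHr !bin0 !muln1 mul1n.
  rewrite size_allpairs_dep sumnE big_map -/(index_iota 0 p.+1).
  rewrite big_nat_recr //= subnn big_nat big1 => [|j /andP[_ lt_jp]].
    by rewrite addn1.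
  by rewrite -[p - j]prednK // subn_gt0.
rewrite forestsSS size_cat size_map size_allpairs_dep sumnE big_map.
rewrite -[iota 0 p.+1]/(index_iota 0 p.+1) mulnDr {}IHr.
set S := \sum_(_ <- _) _.
have SE : k.+1 * S = 'C(k.+1 + r + p * e, k) *
    (r.+1 * 'C((p + k).+1, k.+1) + e * 'C((p + k).+1, k.+2)).
  rewrite -sum_bin_diag -sum_mul_bin_diag !big_distrr -big_split big_distrr /=.
  apply: eq_big_nat => j /andP[_ lt_jp]; rewrite IHk.
  have -> : k + ((j * e).+1 + r) + (p - j) * e = k.+1 + r + p * e by nia.
  ring.
(* Absorption gives (k+2) y = p x and (k+1) b = (r+1+pe) a, where a, b are the binomials of k+1+r+pe
   over k, k+1 and x, y those of p+k+1 over k+1, k+2. Both sides then become multiples of a x. *)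
have xy := mul_bin_left (p + k).+1 k.+1; rewrite subSS addnK in xy.
have ab := mul_bin_left (k.+1 + r + p * e) k.
rewrite (_ : _ - k = r.+1 + p * e) in ab; last by lia.
rewrite (_ : k.+1 + r.+1 + p * e = (k.+1 + r + p * e).+1); last by lia.
rewrite binS (addnS p k).
move: SE xy ab; move: {IHk} S 'C(_, k) 'C(_, k.+1) 'C(_, k.+2) 'C(_, k.+1).
move=> S a b y x SE xy ab.
apply/eqP; rewrite -(eqn_pmul2l (ltn0Sn k)); apply/eqP.
have -> : k.+1 * (r * b * x + k.+2 * S) =
    r * (k.+1 * b) * x + k.+2 * (k.+1 * S).
  by ring.
have -> : k.+1 * (r.+1 * (b + a) * x) = r.+1 * (k.+1 * b + k.+1 * a) * x.
  by ring.
rewrite SE ab.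
have -> : k.+2 * (a * (r.+1 * x + e * y)) =
    k.+2 * a * r.+1 * x + a * e * (k.+2 * y).
  by ring.
rewrite xy; ring.
Qed.

Definition unwrap (M : expr) : expr := if M is Lapp N :: _ then N else [::].

Local Open Scope ring_scope.

Theorem theorem2p1 (d n k : nat) (hd : (2 <= d)%N) :
  exists s : seq expr,
    [/\ uniq s,
        forall M : expr,
          M \in s <-> [/\ opmonomial d M, topt d M = n & lopt M = k]
      & (size s)%:R = (n + 1)%:R^-1 * 'C(n + 1, k + 1)%:R
                      * 'C(n + (n - k) * (d - 2) + 1, k)%:R :> rat].
Proof.
have e_gt0 : (0 < d.-1)%N by lia.
have [lt_nk|le_kn] := ltnP n k.
  exists [::]; split=> // [M|]; last first.
    by rewrite bin_small ?ltn_add2r // mulr0 mul0r.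
  by split=> // -[_ nE kE]; move: lt_nk; rewrite -nE -kE ltnNge leq_addr.
(* The extra outermost L turns the condition on the roots of a monomial into one on an outdegree; n
   - k is the number of products. *)
pose t := forests d.-1 k.+1 1 (n - k).
have tP X : X \in t -> X = [:: Lapp (unwrap X)].
  by case/mem_forests => //; case: X => [|[|N] [|]].
exists (map unwrap t); split.
- by rewrite map_inj_in_uniq ?uniq_forests // => X Y /tP-> /tP-> /= ->.
- move=> M; have -> : (M \in map unwrap t) = ([:: Lapp M] \in t).
    by apply/mapP/idP => [[X Xt ->]|Mt]; [rewrite -tP | exists [:: Lapp M]].
  rewrite mem_forests // lopt_cons indets_cons flopt_Lapp findets_Lapp !addn0.
  rewrite /= andbT; split.
    case=> _ [lM] iM /opmonomialP-/(_ hd) opM; split=> //.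
    by rewrite /topt lM iM /= mulnK // subnKC.
  case=> opM; have [q qE] := opmonomial_indets hd opM.
  rewrite /topt qE /= mulnK // => nE lM; split=> //; first by rewrite lM.
    by rewrite add1n -nE lM addKn.
  exact/opmonomialP.
rewrite size_map.
have := size_forests d.-1 k 1 (n - k); rewrite -/t mul1n subnK // => szt.
have -> : (n + (n - k) * (d - 2) + 1 = k + 1 + (n - k) * d.-1)%N by nia.
(* (n+1) 'C(n, k) = (k+1) 'C(n+1, k+1) trades the factor 1/(k+1) of [size_forests] for 1/(n+1). *)
have := mul_bin_diag n.+1 k; rewrite /= => binE.
have k1 : k.+1%:R != 0 :> rat by rewrite pnatr_eq0.
have n1 : n.+1%:R != 0 :> rat by rewrite pnatr_eq0.
apply: (mulfI k1); rewrite -natrM szt !addn1.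
apply: (mulfI n1); rewrite !mulrA [n.+1%:R * k.+1%:R]mulrC mulfK //.
rewrite -!natrM -binE; congr (_%:R); ring.
Qed.
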